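(* The following hold: (1) A division ring $R$ is UnitUC if and only if $R\cong\mathbb{F}_2$. (2) A semisimple ring $R$ is UnitUC if and only if $R\cong\mathbb{F}_2\times\cdots\times\mathbb{F}_2$ (a finite direct product of copies of $\mathbb{F}_2$). (3) A local ring $R$ is UnitUC if and only if $R/J(R)\cong\mathbb{F}_2$. (4) If a semilocal ring $R$ is UnitUC, then $R/J(R)\cong\mathbb{F}_2\times\cdots\times\mathbb{F}_2$ (a finite direct product of copies of $\mathbb{F}_2$).
   Context: Rings are associative with $1\neq 0$, not necessarily commutative; $J(R)$ is the Jacobson radical, $U(R)$ the group of units, $Id(R)$ the set of idempotents of $R$; $\mathbb{F}_2$ is the field with two elements. Local means $R/J(R)$ is a division ring; semilocal means $R/J(R)$ is semisimple (Artinian). A ring $R$ is clean if every $a\in R$ can be written as $a=e+u$ with $e\in Id(R)$, $u\in U(R)$. For $e,f\in Id(R)$ write $e\sim f$ if there is $u\in U(R)$ with $e=u^{-1}fu$. $R$ is unit uniquely clean (UnitUC) if it is clean and, whenever $e+u=f+v$ with $e,f\in Id(R)$ and $u,v\in U(R)$, one has $e\sim f$. *)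

(* Defs.v *)
From HB Require Import structures.
From mathcomp Require Import all_boot all_algebra generic_quotient.
From mathcomp Require Import boolp classical_sets.

Set Implicit Arguments.
Unset Strict Implicit.
Unset Printing Implicit Defensive.

Import GRing.Theory.
Local Open Scope ring_scope.
Local Open Scope classical_set_scope.
Local Open Scope quotient_scope.

(* A ring is an nzRingType: associative, 1 != 0, not assumed commutative.
   Units are two-sided invertible elements, stated in Prop so that no
   unitRingType structure (a chosen inverse) is imposed on the ring. *)
Definition inverses (R : nzRingType) (u v : R) : Prop := u * v = 1 /\ v * u = 1.

Definition is_unit (R : nzRingType) (u : R) : Prop := exists v, inverses u v.

Definition is_idempotent (R : nzRingType) (e : R) : Prop := e * e = e.

Definition clean (R : nzRingType) : Prop :=
  forall a : R, exists e u : R, [/\ is_idempotent e, is_unit u & a = e + u].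

(* e = u^-1 f u for some unit u, with v standing for u^-1 *)
Definition unit_equiv (R : nzRingType) (e f : R) : Prop :=
  exists u v : R, inverses u v /\ e = v * f * u.

Definition UnitUC (R : nzRingType) : Prop :=
  clean R /\
  forall e f u v : R, is_idempotent e -> is_idempotent f -> is_unit u -> is_unit v ->
    e + u = f + v -> unit_equiv e f.

Definition division_ring (R : nzRingType) : Prop :=
  forall x : R, x <> 0 -> is_unit x.

Definition left_ideal (R : nzRingType) (I : set R) : Prop :=
  [/\ I 0, forall x y, I x -> I y -> I (x + y) & forall a x, I x -> I (a * x)].

(* Every left ideal is a direct summand, i.e. the left regular module is
   semisimple. *)
Definition semisimple_ring (R : nzRingType) : Prop :=
  forall I : set R, left_ideal I ->
    exists K : set R, [/\ left_ideal K,
      forall x, exists i k, [/\ I i, K k & x = i + k] & I `&` K = [set 0]].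

Definition maximal_left_ideal (R : nzRingType) (M : set R) : Prop :=
  [/\ left_ideal M, M <> setT &
      forall N, left_ideal N -> M `<=` N -> N = M \/ N = setT].

(* The Jacobson radical: the intersection of all maximal left ideals. *)
Definition jacobson (R : nzRingType) : {pred R} :=
  fun x => `[< forall M, maximal_left_ideal M -> M x >].
Arguments jacobson : clear implicits.

Definition ring_iso (R S : pzRingType) : Prop :=
  exists f : {rmorphism R -> S}, bijective f.

(* {ffun 'I_n -> 'F_2} carries the pointwise ring operations. *)
Definition iso_F2_power (R : pzRingType) : Prop :=
  exists n : nat, ring_iso R {ffun 'I_n.+1 -> 'F_2}.

Section JacobsonIdeal.
Variable R : nzRingType.
Implicit Types (x y a : R) (M N : set R).

Lemma left_idealN M x : left_ideal M -> M x -> M (- x).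
Proof. by case=> _ _ h Mx; rewrite -mulN1r; apply: h. Qed.

Lemma left_ideal1 M : left_ideal M -> M 1 -> M = setT.
Proof.
case=> _ _ h M1; apply/seteqP; split=> // x _.
by rewrite -[x]mulr1; apply: h.
Qed.

Lemma maximal_left_idealP M x : maximal_left_ideal M -> ~ M x ->
  exists a, M (1 - a * x).
Proof.
move=> [[M0 MD MM] _ Mmax] nMx.
pose N := [set z | exists a, M (z - a * x)].
have lN : left_ideal N.
  split; first by exists 0; rewrite mul0r subr0.
    move=> y z [a Ma] [b Mb]; exists (a + b).
    by rewrite mulrDl opprD addrACA; apply: MD.
  move=> a z [b Mb]; exists (a * b).
  by rewrite -mulrA -mulrBr; apply: MM.
have MN : M `<=` N by move=> z Mz; exists 0; rewrite mul0r subr0.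
case: (Mmax N lN MN) => [NM|NT].
  by case: nMx; rewrite -NM; exists 1; rewrite mul1r subrr.
by have : N 1 by rewrite NT.
Qed.

Lemma maximal_left_ideal_colon M x : maximal_left_ideal M -> ~ M x ->
  maximal_left_ideal [set z | M (z * x)].
Proof.
move=> Mm nMx; have [[M0 MD MM] _ _] := Mm.
split.
- split; first by rewrite /= mul0r.
    by move=> y z /= My Mz; rewrite mulrDl; apply: MD.
  by move=> a z /= Mz; rewrite -mulrA; apply: MM.
- move=> E; apply: nMx; have : [set z | M (z * x)] 1 by rewrite E.
  by rewrite /= mul1r.
move=> N lN sub; have [N0 ND NM] := lN.
have [[n Nn nMn]|H] := pselect (exists2 n, N n & ~ M (n * x)); last first.
  left; apply/seteqP; split=> // n Nn /=.
  by apply: contrapT => nMn; apply: H; exists n.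
right; apply: left_ideal1 => //.
have [a Ma] := maximal_left_idealP Mm nMn.
have : N (1 - x * a * n).
  apply: sub => /=; rewrite mulrBl mul1r -[X in X - _]mulr1 -!mulrA -mulrBr.
  exact: MM.
by move=> /ND /(_ (NM (x * a) _ Nn)); rewrite subrK.
Qed.

Lemma jacobsonP x :
  reflect (forall M, maximal_left_ideal M -> M x) (x \in jacobson R).
Proof. exact: asboolP. Qed.

Lemma jacobson_zmod_closed : zmod_closed (jacobson R).
Proof.
split; first by apply/jacobsonP => M [[]].
move=> x y /jacobsonP Jx /jacobsonP Jy; apply/jacobsonP => M Mm.
have [lM _ _] := Mm; have [_ MD _] := lM.
by apply: MD; [exact: Jx | apply: left_idealN => //; exact: Jy].
Qed.

HB.instance Definition _ :=
  GRing.isZmodClosed.Build R (jacobson R) jacobson_zmod_closed.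

Lemma jacobsonMl a x : x \in jacobson R -> a * x \in jacobson R.
Proof.
move=> /jacobsonP Jx; apply/jacobsonP => M Mm.
by have [[_ _ MM] _ _] := Mm; apply: MM; exact: Jx.
Qed.

Lemma jacobsonMr a x : x \in jacobson R -> x * a \in jacobson R.
Proof.
move=> /jacobsonP Jx; apply/jacobsonP => M Mm.
have [Ma|nMa] := pselect (M a); first by have [[_ _ MM] _ _] := Mm; apply: MM.
exact: (Jx _ (maximal_left_ideal_colon Mm nMa)).
Qed.

Lemma maximal_left_ideal_exists : exists M, @maximal_left_ideal R M.
Proof.
pose P (A : set R) := [/\ ~ A 1, forall x y, A x -> A y -> A (x + y)
  & forall a x, A x -> A (a * x)].
have [F FP Ftot|A [[A1 AD AM] Amax]] := @Zorn_bigcup R P.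
  split.
  - by move=> [X /FP [X1 _ _]].
  - move=> x y [X FX Xx] [Y FY Yy]; case: (Ftot X Y FX FY) => s.
      by exists Y => //; have [_ YD _] := FP _ FY; apply: YD => //; apply: s.
    by exists X => //; have [_ XD _] := FP _ FX; apply: XD => //; apply: s.
  - by move=> a x [X FX Xx]; exists X => //; have [_ _ XM] := FP _ FX; apply: XM.
have A0 : A 0.
  apply: contrapT => nA0; apply: (Amax [set 0]).
    split; last by move=> /(_ 0 erefl).
    by move=> x Ax; case: nA0; rewrite -(mul0r x); apply: AM.
  split => /=; first by apply/eqP; rewrite oner_eq0.
    by move=> x y /= -> ->; rewrite addr0.
  by move=> a x /= ->; rewrite mulr0.
exists A; split=> //; first by move=> E; apply: A1; rewrite E.
move=> N lN AN; have [N1|nN1] := pselect (N 1); first by right; exact: left_ideal1.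
left; apply/seteqP; split=> //.
apply: contrapT => nNA; apply: (Amax N); first by split.
by case: lN => *; split.
Qed.

Lemma jacobson1 : 1 \notin jacobson R.
Proof.
apply/negP => /jacobsonP J1; have [M Mm] := maximal_left_ideal_exists.
by have [lM MT _] := Mm; apply: MT; apply: left_ideal1 => //; exact: J1.
Qed.

End JacobsonIdeal.

(* R / J(R).  The additive quotient group comes from ring_quotient, whose ring
   structure is restricted to commutative rings; the product is added here. *)
Definition Jquot (R : nzRingType) : Type := Quotient.quot (jacobson R).

Section JacobsonQuotient.
Variable R : nzRingType.

HB.instance Definition _ := GRing.Zmodule.on (Jquot R).
HB.instance Definition _ := EqQuotient.on (Jquot R).

Definition Jone : Jquot R := \pi_(Jquot R) 1.
Definition Jmul (x y : Jquot R) : Jquot R := \pi_(Jquot R) (repr x * repr y).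

Lemma eq_Jquot (x y : R) :
  (\pi_(Jquot R) x == \pi_(Jquot R) y) = (x - y \in jacobson R).
Proof. exact/esym/(Quotient.idealrBE (jacobson R)). Qed.

Lemma pi_Jmul (x y : R) :
  \pi_(Jquot R) (x * y) = Jmul (\pi_(Jquot R) x) (\pi_(Jquot R) y).
Proof.
apply/eqP; rewrite eq_Jquot.
set x' := repr _; set y' := repr _.
have Jx : x - x' \in jacobson R by rewrite -eq_Jquot reprK.
have Jy : y - y' \in jacobson R by rewrite -eq_Jquot reprK.
have -> : x * y - x' * y' = (x - x') * y + x' * (y - y').
  by rewrite mulrBl mulrBr addrA subrK.
by apply: rpredD; [exact: jacobsonMr | exact: jacobsonMl].
Qed.

Lemma pi_Jadd (x y : R) :
  \pi_(Jquot R) (x + y) = \pi_(Jquot R) x + \pi_(Jquot R) y.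
Proof. exact: (Quotient.pi_add (jacobson R) x y). Qed.

Lemma JmulA : associative Jmul.
Proof.
elim/quotW=> x; elim/quotW=> y; elim/quotW=> z.
by rewrite -(pi_Jmul y z) -(pi_Jmul x y) -!pi_Jmul mulrA.
Qed.

Lemma Jmul1 : left_id Jone Jmul.
Proof. by elim/quotW=> x; rewrite -pi_Jmul mul1r. Qed.

Lemma Jmulr1 : right_id Jone Jmul.
Proof. by elim/quotW=> x; rewrite -pi_Jmul mulr1. Qed.

Lemma JmulDl : left_distributive Jmul +%R.
Proof.
elim/quotW=> x; elim/quotW=> y; elim/quotW=> z.
by rewrite -pi_Jadd -!pi_Jmul -pi_Jadd mulrDl.
Qed.

Lemma JmulDr : right_distributive Jmul +%R.
Proof.
elim/quotW=> x; elim/quotW=> y; elim/quotW=> z.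
by rewrite -pi_Jadd -!pi_Jmul -pi_Jadd mulrDr.
Qed.

Lemma Jone_neq0 : Jone != 0.
Proof.
have -> : 0 = \pi_(Jquot R) 0 :> Jquot R by rewrite piE.
by rewrite eq_Jquot subr0 jacobson1.
Qed.

HB.instance Definition _ := GRing.Zmodule_isNzRing.Build (Jquot R)
  JmulA Jmul1 Jmulr1 JmulDl JmulDr Jone_neq0.

End JacobsonQuotient.

Definition local_ring (R : nzRingType) : Prop := division_ring (Jquot R).

Definition semilocal_ring (R : nzRingType) : Prop := semisimple_ring (Jquot R).

(* Main.v *)
(* A von Neumann regular UnitUC ring R is Boolean.  If h is a nonzero idempotent
   and u, u - h are both units of hRh, then u + (1 - h) = 0 + (u + (1 - h))
   = h + (u - h + (1 - h)) are clean decompositions with non-conjugate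
   idempotents 0 and h.  Applied to 2 x 2 matrix units inside hRh this makes all
   idempotents central; then each x is a unit of eR for a central idempotent e,
   and a second application forces x = e.  Semisimple rings are regular, and a
   Boolean ring with principal ideals is a finite sum of atoms, hence a power of
   F_2.  Since units lift modulo J(R), and idempotents do so in a clean ring,
   UnitUC passes to R/J(R). *)

Require Import Defs.
From mathcomp Require Import all_boot all_algebra.
From HB Require Import structures.
From mathcomp Require Import generic_quotient boolp classical_sets.

Set Implicit Arguments.
Unset Strict Implicit.
Unset Printing Implicit Defensive.

Import GRing.Theory.
Local Open Scope ring_scope.
Local Open Scope classical_set_scope.
Local Open Scope quotient_scope.

(** * Units of corner rings and non-conjugate clean decompositions *)

Definition boolean_ring (R : pzRingType) : Prop := forall x : R, x * x = x.

Definition regular_ring (R : nzRingType) : Prop :=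
  forall x : R, exists y, x * y * x = x.

(* u is invertible in the corner ring h R h *)
Definition corner_unit (R : nzRingType) (h u : R) : Prop :=
  exists w, [/\ h * u = u, u * h = u, h * w = w, w * h = w
              & u * w = h /\ w * u = h].

Lemma is_unit1 (R : nzRingType) : is_unit (1 : R).
Proof. by exists 1; rewrite /inverses mulr1. Qed.

Lemma left_right_inverse_is_unit (R : nzRingType) (u v w : R) :
  u * v = 1 -> w * u = 1 -> is_unit u.
Proof.
by move=> uv wu; exists v; split=> //; rewrite -[v]mul1r -wu -(mulrA w) uv mulr1.
Qed.

(** The sum is block diagonal for the Peirce decomposition at [h]: cross terms vanish, and the
    inverse is [w + (1 - h)]. *)
Lemma corner_unit_extend (R : nzRingType) (h u : R) :
  corner_unit h u -> is_unit (u + (1 - h)).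
Proof.
case=> w [hu uh hw wh [uw wu]].
have hh : h * h = h by rewrite -{2}uw mulrA hu.
have extM (a b : R) : h * b = b -> a * h = a -> a * b = h ->
    (a + (1 - h)) * (b + (1 - h)) = 1.
  move=> hb ah ab; set c := 1 - h.
  have ac : a * c = 0 by rewrite mulrBr mulr1 ah subrr.
  have cb : c * b = 0 by rewrite mulrBl mul1r hb subrr.
  have cc : c * c = c by rewrite {2}/c mulrBr mulr1 mulrBl mul1r hh subrr subr0.
  by rewrite mulrDl !(mulrDr _ b) ab ac cb cc addr0 add0r addrC subrK.
by exists (w + (1 - h)); split; apply: extM.
Qed.

Lemma UnitUC_corner_eq0 (R : nzRingType) (h u : R) : UnitUC R ->
  corner_unit h u -> corner_unit h (u - h) -> h = 0.
Proof.
move=> [_ uc] cu cuh; have hh : h * h = h.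
  by case: cu => w [hu _ _ _ [uw _]]; rewrite -{2}uw mulrA hu.
have [] := uc 0 h _ _ _ hh (corner_unit_extend cu) (corner_unit_extend cuh).
- by rewrite /is_idempotent mulr0.
- by rewrite add0r [RHS]addrA [h + _]addrC subrK.
move=> v [w [[vw wv] E]].
by rewrite -[h]mul1r -[1 * h]mulr1 -vw -!mulrA (mulrA w) (mulrA (w * h)) -E
  mul0r mulr0.
Qed.

(* x and y are the off-diagonal matrix units of h R h, h = xy + yx; the matrix
   u = [0 1; 1 1] satisfies u * (u - 1) = 1 in every characteristic. *)
Lemma UnitUC_matrix_unit_eq0 (R : nzRingType) (x y : R) : UnitUC R ->
  x * x = 0 -> y * y = 0 -> x * y * x = x -> y * x * y = y -> x = 0.
Proof.
move=> uc xx yy xyx yxy.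
pose h := x * y + y * x; pose u := x + y + y * x; pose w := x + y - x * y.
have uhE : u - h = w by rewrite /u /h opprD [- (x * y) + _]addrC addrA addrK.
have hx : h * x = x by rewrite mulrDl xyx -mulrA xx mulr0 addr0.
have xh : x * h = x by rewrite mulrDr !mulrA xx mul0r add0r xyx.
have hy : h * y = y by rewrite mulrDl yxy -mulrA yy mulr0 add0r.
have yh : y * h = y by rewrite mulrDr !mulrA yy mul0r addr0 yxy.
have hu : h * u = u by rewrite !mulrDr (mulrA h) hx hy.
have uh : u * h = u by rewrite !mulrDl -(mulrA y) xh yh.
have hw : h * w = w by rewrite mulrBr !mulrDr (mulrA h) hx hy.
have wh : w * h = w by rewrite mulrBl !mulrDl -(mulrA x) xh yh.
have uw : u * w = h.
  rewrite /u /w !mulrDl !mulrBr !mulrDr !mulrA xx yy yxy !mul0r -(mulrA y x x) xx.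
  by rewrite mulr0 !mul0r !add0r !addr0 !subr0 -addrA subrK.
have wu : w * u = h.
  rewrite /u /w mulrBl !mulrDl !mulrDr !mulrA xx yy xyx -(mulrA x y y) yy !mul0r.
  by rewrite mulr0 !mul0r !add0r !addr0 addrAC addrK.
have h0 : h = 0.
  by apply: (@UnitUC_corner_eq0 _ h u) => //; [exists w | rewrite uhE; exists u].
by rewrite -hx h0 mul0r.
Qed.

(** * Von Neumann regular UnitUC rings *)

(** A von Neumann inverse of the corner element [x] can be moved into the opposite corner, which
    turns the pair into off-diagonal matrix units. *)
Lemma UnitUC_regular_peirce (R : nzRingType) (e r : R) : UnitUC R ->
  regular_ring R -> is_idempotent e -> e * r * (1 - e) = 0.
Proof.
move=> uc reg ee; set x := e * r * (1 - e).
have ee' : e * (1 - e) = 0 by rewrite mulrBr mulr1 ee subrr.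
have e'e : (1 - e) * e = 0 by rewrite mulrBl mul1r ee subrr.
have ex : e * x = x by rewrite /x !mulrA ee.
have xe : x * e = 0 by rewrite /x -mulrA e'e mulr0.
have xe' : x * (1 - e) = x by rewrite mulrBr mulr1 xe subr0.
clearbody x.
have [z xzx] := reg x.
(* [y1] is a reflexive inverse: also [y1 * x * y1 = y1]. Compressing it to [(1 - e) R e] forces
   [y * y = 0] and keeps both relations, because [x] lies in [e R (1 - e)]. *)
pose y1 := z * x * z; pose y := (1 - e) * y1 * e.
have xy1x : x * y1 * x = x by rewrite /y1 !mulrA xzx xzx.
have y1xy1 : y1 * x * y1 = y1.
  have zxzx : z * x * z * x = z * x by rewrite -!mulrA (mulrA x) xzx.
  by rewrite /y1 !mulrA !zxzx.
clearbody y1.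
apply: (@UnitUC_matrix_unit_eq0 _ x y) => //.
- by rewrite -{2}ex mulrA xe mul0r.
- by rewrite /y -!mulrA (mulrA e (1 - e)) ee' mul0r !mulr0.
- by rewrite /y -!mulrA ex !mulrA xe' xy1x.
- by rewrite /y -!mulrA (mulrA e x) ex (mulrA x (1 - e)) xe' (mulrA x y1)
    (mulrA y1 (x * y1)) (mulrA y1 x) y1xy1.
Qed.

(** Both off-diagonal Peirce corners vanish, so [e r = e r e = r e]. *)
Lemma UnitUC_regular_idempotent_central (R : nzRingType) (e r : R) : UnitUC R ->
  regular_ring R -> is_idempotent e -> e * r = r * e.
Proof.
move=> uc reg ee.
have ee' : is_idempotent (1 - e).
  by rewrite /is_idempotent mulrBl mul1r mulrBr mulr1 ee subrr subr0.
have /eqP := UnitUC_regular_peirce r uc reg ee.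
have /eqP := UnitUC_regular_peirce r uc reg ee'.
rewrite subKr mulrBl mul1r mulrBl mulrBr mulr1 !subr_eq0.
by move=> /eqP -> /eqP.
Qed.

(** The idempotents [x y] and [y x] are central, and their product equals each of them. *)
Lemma UnitUC_regular_inverse_comm (R : nzRingType) (x y : R) : UnitUC R ->
  regular_ring R -> x * y * x = x -> x * y = y * x.
Proof.
move=> uc reg xyx.
have central (e r : R) : e * e = e -> e * r = r * e.
  by move=> ?; apply: UnitUC_regular_idempotent_central.
have ee : (x * y) * (x * y) = x * y by rewrite mulrA xyx.
have gg : (y * x) * (y * x) = y * x by rewrite -mulrA (mulrA x) xyx.
have <- : (y * x) * (x * y) = x * y.
  by rewrite mulrA (central _ x gg) !mulrA xyx.
by rewrite (central _ (x * y) gg) mulrA (central _ y ee) -mulrA xyx.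
Qed.

(* For e = xy = yx and z = x - e = z t z, the element x f is invertible in fR
   for f = zt = tz, and so is x f - f = z. *)
Lemma UnitUC_regular_boolean (R : nzRingType) : UnitUC R -> regular_ring R ->
  boolean_ring R.
Proof.
move=> uc reg x.
have [y xyx] := reg x; pose e := x * y.
have ey : y * x = e by rewrite -(UnitUC_regular_inverse_comm uc reg xyx).
have ee : e * e = e by rewrite /e mulrA xyx.
pose z := x - e.
have ez : e * z = z by rewrite mulrBr ee {1}/e xyx.
have [t ztz] := reg z; pose f := z * t.
have ft : t * z = f by rewrite -(UnitUC_regular_inverse_comm uc reg ztz).
have ff : f * f = f by rewrite /f mulrA ztz.
have fC (r : R) : f * r = r * f by apply: UnitUC_regular_idempotent_central.
have ef : e * f = f by rewrite /f mulrA ez.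
have fz : f * z = z by [].
have zf : x * f - f = z by rewrite -{2}ef -mulrBl -fC.
suff f0 : f = 0.
  have : z = 0 by rewrite -fz f0 mul0r.
  by move/eqP; rewrite subr_eq0 => /eqP ->.
have ffr (r : R) : f * (r * f) = r * f by rewrite fC -mulrA ff.
have rff (r : R) : r * f * f = r * f by rewrite -mulrA ff.
apply: (@UnitUC_corner_eq0 _ f (x * f)) => //.
  exists (y * f); split=> //.
  by split; rewrite -mulrA ffr mulrA ?ey.
rewrite zf; exists (t * f); split=> //; first by rewrite -fC.
split; first by rewrite mulrA.
by rewrite -mulrA fz.
Qed.

(** * Semisimple rings and Boolean rings *)

(** Write [1 = i + k] along a complement [K]; for [x] in [I], the element [x k = x - x i] lies in
    both [I] and [K]. *)
Lemma semisimple_left_ideal_generator (R : nzRingType) (I : set R) :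
  semisimple_ring R -> left_ideal I ->
  exists2 i, I i & forall x, I x -> x = x * i.
Proof.
move=> ss lI; have [K [[_ KD KM] IK IK0]] := ss I lI.
have [i [k [Ii Kk E]]] := IK 1; exists i => // x Ix.
have xk : x = x * i + x * k by rewrite -mulrDr -E mulr1.
suff xk0 : x * k = 0 by rewrite {1}xk xk0 addr0.
suff : [set 0] (x * k) by [].
rewrite -IK0; split; last exact: KM.
have -> : x * k = x - x * i by rewrite {2}xk addrAC subrr add0r.
by case: (lI) => _ ID IM; apply: ID => //; apply: left_idealN => //; apply: IM.
Qed.

(** The right-identity generator of [R x] has the form [a x], whence [x = x (a x)]. *)
Lemma semisimple_regular (R : nzRingType) : semisimple_ring R -> regular_ring R.
Proof.
move=> ss x; have lI : left_ideal [set y | exists a, y = a * x].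
  split; first by exists 0; rewrite mul0r.
    by move=> y z [a ->] [b ->]; exists (a + b); rewrite mulrDl.
  by move=> a y [b ->]; exists (a * b); rewrite mulrA.
have [i [a ->] gen] := semisimple_left_ideal_generator ss lI.
by exists a; rewrite -mulrA -gen //; exists 1; rewrite mul1r.
Qed.

Lemma semisimple_UnitUC_boolean (R : nzRingType) : semisimple_ring R ->
  UnitUC R -> boolean_ring R.
Proof. by move=> ss uc; apply: UnitUC_regular_boolean (semisimple_regular ss). Qed.

Lemma boolean_addxx (R : nzRingType) (x : R) : boolean_ring R -> x + x = 0.
Proof.
move=> bR; have := bR (x + x); rewrite mulrDl mulrDr bR => /eqP.
by rewrite -subr_eq0 addrK => /eqP.
Qed.

Lemma boolean_mulC (R : nzRingType) (x y : R) : boolean_ring R -> x * y = y * x.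
Proof.
move=> bR; have := bR (x + y); rewrite mulrDl !mulrDr !bR addrA => /addIr.
rewrite -addrA -[RHS]addr0 => /addrI E.
by rewrite -[RHS]add0r -E -addrA boolean_addxx // addr0.
Qed.

(** The only unit is 1, since [u = u (u v) = u v]; hence [e + u = f + v] already gives [e = f]. *)
Lemma boolean_UnitUC (R : nzRingType) : boolean_ring R -> UnitUC R.
Proof.
move=> bR; have unit1 (u : R) : is_unit u -> u = 1.
  by case=> v [uv _]; rewrite -[LHS]mulr1 -uv mulrA bR.
split=> [a|e f u v _ _ /unit1 -> /unit1 -> /addIr ->].
  by exists (a - 1), 1; split; [exact: bR | exact: is_unit1 | rewrite subrK].
by exists 1, 1; split; [split; rewrite mulr1 | rewrite mulr1 mul1r].
Qed.

Lemma ring_iso_boolean (R S : pzRingType) : ring_iso R S -> boolean_ring S ->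
  boolean_ring R.
Proof.
by case=> f /bij_inj inj bS x; apply: inj; rewrite rmorphM; apply: bS.
Qed.

Lemma ring_isoI (R S : pzRingType) (f : R -> S) : {morph f : x y / x + y} ->
  f 1 = 1 -> {morph f : x y / x * y} -> bijective f -> ring_iso R S.
Proof.
move=> fD f1 fM fbij.
have fB : zmod_morphism f by move=> x y; apply: (addIr (f y)); rewrite -fD !subrK.
pose fA := GRing.isZmodMorphism.Build R S f fB.
pose fR := GRing.isMonoidMorphism.Build R S f (f1, fM).
by pose F : {rmorphism R -> S} := HB.pack f fA fR; exists F.
Qed.

(** * Atoms and coordinates in F_2 *)

Definition atom (R : nzRingType) (a : R) : Prop :=
  a <> 0 /\ forall x, x * a = 0 \/ x * a = a.

(** For an atom [a] of a Boolean ring, this is the projection onto the factor [R a] = {0, a}, read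
    in F_2. *)
Definition atom_coord (R : nzRingType) (a x : R) : 'F_2 := (x * a == a)%:R.

Lemma atom_coordD (R : nzRingType) (a : R) : boolean_ring R -> atom a ->
  {morph atom_coord a : x y / x + y}.
Proof.
move=> bR [/eqP a0 aP] x y; rewrite /atom_coord mulrDl.
have na : (0 == a) = false by rewrite eq_sym (negbTE a0).
by case: (aP x) => ->; case: (aP y) => ->;
  rewrite ?(boolean_addxx _ bR) ?addr0 ?add0r ?eqxx ?na; apply/eqP.
Qed.

Lemma atom_coord1 (R : nzRingType) (a : R) : atom_coord a 1 = 1.
Proof. by rewrite /atom_coord mul1r eqxx. Qed.

Lemma atom_coordM (R : nzRingType) (a : R) : atom a ->
  {morph atom_coord a : x y / x * y}.
Proof.
move=> [/eqP a0 aP] x y; rewrite /atom_coord -mulrA.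
have na : (0 == a) = false by rewrite eq_sym (negbTE a0).
by case: (aP y) => ->; rewrite ?mulr0 ?eqxx ?na ?mulr0 ?mulr1.
Qed.

Lemma F2E (i : 'F_2) : i = (i == 1)%:R.
Proof. by case: i => [[|[|m]] im]; apply/val_inj. Qed.

Lemma F2_iso (R : nzRingType) : (forall x : R, x = 0 \/ x = 1) -> ring_iso R 'F_2.
Proof.
move=> R01; have bR : boolean_ring R.
  by move=> x; case: (R01 x) => ->; rewrite ?mulr0 ?mulr1.
have at1 : atom (1 : R).
  by split=> [|x]; [apply/eqP; exact: oner_neq0 | rewrite mulr1].
have n01 : (0 == 1 :> R) = false by rewrite eq_sym oner_eq0.
apply: (ring_isoI (f := atom_coord 1)).
- exact: atom_coordD.
- exact: atom_coord1.
- exact: atom_coordM.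
exists (fun i : 'F_2 => (i == 1)%:R : R) => [x|i]; last first.
  rewrite [RHS]F2E /atom_coord mulr1.
  by case: (i == 1); rewrite ?eqxx ?n01.
by rewrite /atom_coord mulr1; case: (R01 x) => ->; rewrite ?eqxx ?n01.
Qed.

Lemma boolean_F2_power (n : nat) : boolean_ring {ffun 'I_n.+1 -> 'F_2}.
Proof.
move=> f; apply/ffunP => i; rewrite ffunE [f i]F2E.
by case: (f i == 1); rewrite ?mulr0 ?mulr1.
Qed.

Lemma boolean_F2 : boolean_ring 'F_2.
Proof. by move=> i; rewrite [i]F2E; case: (i == 1); rewrite ?mulr0 ?mulr1. Qed.

(** * Lifting units and idempotents modulo the Jacobson radical *)

Lemma maximal_left_ideal_above (R : nzRingType) (I : set R) : left_ideal I ->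
  ~ I 1 -> exists2 M, maximal_left_ideal M & I `<=` M.
Proof.
move=> lI I1.
(* Adjoining I keeps the empty chain's union in P. *)
pose P (A : set R) := left_ideal (A `|` I) /\ ~ (A `|` I) 1.
have [F FP Ftot|A [[lA A1] Amax]] := @Zorn_bigcup R P.
  have [[X0 FX0]|nF] := pselect (exists X, F X); last first.
    have -> : \bigcup_(X in F) X = set0.
      by apply/seteqP; split=> // x [X FX]; case: nF; exists X.
    by rewrite /P set0U.
  have UE x : (\bigcup_(X in F) X `|` I) x <-> exists2 X, F X & (X `|` I) x.
    split=> [[[X FX Xx]|Ix]|[X FX [Xx|Ix]]]; last by right.
    - by exists X => //; left.
    - by exists X0 => //; right.
    - by left; exists X.
  split; last by move=> /UE [X /FP [_]].
  split; first by apply/UE; exists X0 => //; case: (FP _ FX0) => -[].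
    move=> x y /UE [X FX Xx] /UE [Y FY Yy]; apply/UE.
    have [Z [FZ Zx Zy]] : exists Z, [/\ F Z, (Z `|` I) x & (Z `|` I) y].
      case: (Ftot X Y FX FY) => sub; [exists Y | exists X]; split=> //.
        by case: Xx => [/sub|]; [left | right].
      by case: Yy => [/sub|]; [left | right].
    by exists Z => //; have [[_ ZD _] _] := FP _ FZ; apply: ZD.
  move=> a x /UE [X FX Xx]; apply/UE; exists X => //.
  by have [[_ _ XM] _] := FP _ FX; apply: XM.
exists (A `|` I); last by move=> x; right.
split=> // [E|N lN AN]; first by apply: A1; rewrite E.
have [N1|nN1] := pselect (N 1); first by right; exact: left_ideal1.
left; apply/seteqP; split=> // x Nx; apply: contrapT => nAx.
have NI : N `|` I = N.
  by apply/seteqP; split=> [y [//|Iy]|y]; [apply: AN; right | left].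
apply: (Amax N); last by rewrite /P NI.
by split=> [y Ay|sub]; [apply: AN; left | apply: nAx; left; exact: sub].
Qed.

(** If [1 - y] had no left inverse, a maximal left ideal would contain [R (1 - y)] as well as [y],
    hence 1. The left inverse [a = 1 + a x] is again 1 minus a radical element, so it too is left
    invertible, and its left inverse must be [1 - x]. *)
Lemma jacobson_unit1B (R : nzRingType) (x : R) : x \in jacobson R ->
  is_unit (1 - x).
Proof.
have linv (y : R) : y \in jacobson R -> exists a, a * (1 - y) = 1.
  move=> /jacobsonP Jy; apply: contrapT => no.
  have lI : left_ideal [set z | exists a, z = a * (1 - y)].
    split; first by exists 0; rewrite mul0r.
      by move=> _ _ [a ->] [b ->]; exists (a + b); rewrite mulrDl.
    by move=> a _ [b ->]; exists (a * b); rewrite mulrA.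
  have [|M Mm sub] := maximal_left_ideal_above lI.
    by move=> [a E]; apply: no; exists a.
  have [lM MT _] := Mm; apply: MT; apply: left_ideal1 => //.
  have [_ MD _] := lM; rewrite -(subrK y 1); apply: MD; last exact: Jy.
  by apply: sub; exists 1; rewrite mul1r.
move=> Jx; have [a ax] := linv x Jx.
have aE : a = 1 - (- (a * x)) by rewrite opprK -ax mulrBr mulr1 subrK.
have [b ba] : exists b, b * a = 1.
  by rewrite aE; apply: linv; rewrite rpredN; exact: jacobsonMl.
have bE : b = 1 - x by rewrite -[b]mulr1 -{1}ax mulrA ba mul1r.
by exists a; split; rewrite // -bE.
Qed.

Lemma pi_JquotM (R : nzRingType) (x y : R) :
  \pi_(Jquot R) (x * y) = \pi_(Jquot R) x * \pi_(Jquot R) y.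
Proof. exact: pi_Jmul. Qed.

(** Both [u v] and [v u] are 1 modulo the radical, hence units, so [u] is invertible on each
    side. *)
Lemma Jquot_unit_lift (R : nzRingType) (u : R) : is_unit (\pi_(Jquot R) u) ->
  is_unit u.
Proof.
case=> v' []; rewrite -[v']reprK; set v := repr v'.
have piM (a b : R) : \pi_(Jquot R) a * \pi_(Jquot R) b = 1 -> is_unit (a * b).
  move=> E; rewrite -[a * b](subKr 1); apply: jacobson_unit1B.
  by rewrite -eq_Jquot pi_JquotM E.
move=> /piM [a [va _]] /piM [b [_ bu]].
by apply: (@left_right_inverse_is_unit _ u (v * a) (b * v)); rewrite -?mulrA // mulrA.
Qed.

(* For a = e + u clean, f = u^-1 (1 - e) u satisfies u (a - f) = a^2 - a. *)
Lemma clean_idempotent_lift (R : nzRingType) (a : R) : clean R ->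
  a * a - a \in jacobson R ->
  exists2 f, is_idempotent f & a - f \in jacobson R.
Proof.
move=> cl Ja; have [e [u [ee [v [uv vu]] aE]]] := cl a.
have ee' : (1 - e) * (1 - e) = 1 - e.
  by rewrite mulrBl mul1r mulrBr mulr1 ee subrr subr0.
exists (v * (1 - e) * u).
  by rewrite /is_idempotent -!mulrA (mulrA u v) uv mul1r (mulrA (1 - e)) ee'.
have -> : a - v * (1 - e) * u = v * (a * a - a).
  have va : a = v * (u * a) by rewrite mulrA vu mul1r.
  rewrite {1}va -!mulrA -mulrBr; congr (v * _).
  rewrite [in RHS]aE [in RHS]mulrDl -aE mulrBl mul1r [e * a](_ : _ = e + e * u);
    last first.
    by rewrite aE mulrDr ee.
  rewrite opprB -(addrA e) [X in _ = _ - X]aE opprD addrACA subrr add0r.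
  by rewrite addrA [u * a + _]addrC.
exact: jacobsonMl.
Qed.

Lemma pi_Jquot_inverses (R : nzRingType) (u v : R) : inverses u v ->
  inverses (\pi_(Jquot R) u) (\pi_(Jquot R) v).
Proof. by case=> uv vu; split; rewrite -pi_JquotM ?uv ?vu. Qed.

Lemma pi_Jquot_is_unit (R : nzRingType) (u : R) : is_unit u ->
  is_unit (\pi_(Jquot R) u).
Proof. by case=> v /pi_Jquot_inverses uv; exists (\pi_(Jquot R) v). Qed.

Lemma UnitUC_Jquot (R : nzRingType) : UnitUC R -> UnitUC (Jquot R).
Proof.
move=> [cl uc].
have lift (e' : Jquot R) : is_idempotent e' ->
    exists2 e : R, is_idempotent e & e' = \pi_(Jquot R) e.
  rewrite -[e']reprK; set a := repr e' => aa.
  have [|f ff Jf] := clean_idempotent_lift (a := a) cl.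
    by rewrite -eq_Jquot pi_JquotM aa.
  by exists f => //; apply/eqP; rewrite eq_Jquot.
split=> [a'|e' f' u' v' /lift [e ee ->] /lift [f ff ->]].
  rewrite -[a']reprK; have [e [u [ee uu ->]]] := cl (repr a').
  exists (\pi_(Jquot R) e), (\pi_(Jquot R) u); split.
  - by rewrite /is_idempotent -pi_JquotM ee.
  - exact: pi_Jquot_is_unit.
  - exact: pi_Jadd.
rewrite -[u']reprK; set u := repr u' => uu vv E.
(* The lift of [v'] is not arbitrary: [e + u - f] makes the two decompositions agree exactly in [R],
   not only modulo the radical. *)
have vE : v' = \pi_(Jquot R) (e + u - f).
  apply: (addrI (\pi_(Jquot R) f)).
  by rewrite -E -!pi_Jadd [f + _]addrC subrK.
have [||s [t [st eE]]] := uc e f u (e + u - f) ee ff (Jquot_unit_lift uu).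
- by apply: Jquot_unit_lift; rewrite -vE.
- by rewrite [RHS]addrC subrK.
exists (\pi_(Jquot R) s), (\pi_(Jquot R) t); split; first exact: pi_Jquot_inverses.
by rewrite eE !pi_JquotM.
Qed.

(** Every element is 0 or 1 modulo the radical, so the only idempotents are 0 and 1 and every unit
    is congruent to 1. Equal decompositions then have congruent, hence equal, idempotents. *)
Lemma Jquot_F2_UnitUC (R : nzRingType) : ring_iso (Jquot R) 'F_2 -> UnitUC R.
Proof.
case=> phi /bij_inj inj.
have pi0 : \pi_(Jquot R) 0 = 0 by rewrite [RHS]piE.
have J01 (x : R) : x \in jacobson R \/ 1 - x \in jacobson R.
  have := F2E (phi (\pi_(Jquot R) x)); case: (_ == 1) => E.
    right; rewrite -eq_Jquot; apply/eqP; apply: inj.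
    by rewrite E [LHS]rmorph1.
  left; rewrite -[x]subr0 -eq_Jquot; apply/eqP; apply: inj.
  by rewrite E pi0 [RHS]rmorph0.
have unitN (x : R) : is_unit x -> is_unit (- x).
  by case=> y [xy yx]; exists (- y); split; rewrite mulrNN.
have Junit (x : R) : is_unit x -> 1 - x \in jacobson R.
  case=> y [xy _]; case: (J01 x) => // Jx.
  by have := jacobsonMr y Jx; rewrite xy => J1; have := jacobson1 R; rewrite J1.
have id01 (e : R) : is_idempotent e ->
    e \in jacobson R /\ e = 0 \/ e \notin jacobson R /\ e = 1.
  (* Here [x (1 - x) = 0] with [1 - x] a unit. *)
  have idJ0 (x : R) : x * x = x -> x \in jacobson R -> x = 0.
    move=> xx /jacobson_unit1B [y [xy _]].
    by rewrite -[x]mulr1 -xy mulrA mulrBr mulr1 xx subrr mul0r.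
  move=> ee; case: (J01 e) => Je; first by left; split=> //; apply: idJ0.
  right; suff e1 : e = 1 by split=> //; rewrite e1 jacobson1.
  apply/eqP; rewrite eq_sym -subr_eq0; apply/eqP; apply: idJ0 => //.
  by rewrite mulrBl mul1r mulrBr mulr1 ee subrr subr0.
split=> [a|e f u v /id01 ee /id01 ff /Junit Ju /Junit Jv E].
  case: (J01 a) => Ja.
    exists 1, (a - 1); split; [exact: mulr1 | | by rewrite addrC subrK].
    by rewrite -opprB; apply: unitN; exact: jacobson_unit1B.
  exists 0, a; split; [exact: mulr0 | | by rewrite add0r].
  by rewrite -[a](subKr 1); exact: jacobson_unit1B.
suff -> : e = f.
  by exists 1, 1; split; [split; rewrite mulr1 | rewrite mulr1 mul1r].
have Jef : e - f \in jacobson R.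
  have -> : e - f = (1 - u) - (1 - v).
    rewrite opprB [RHS]addrC addrA subrK; apply: (addIr u).
    by rewrite addrAC E addrAC subrr add0r subrK.
  exact: rpredB.
case: ee => -[Je eE]; case: ff => -[Jf fE]; rewrite ?eE ?fE //.
  by move: Jf; rewrite -(subKr e f) rpredB.
by move: Je; rewrite -(subrK f e) rpredD.
Qed.

(** * Decomposition of 1 into orthogonal atoms *)

Lemma boolean_mul_atom (R : nzRingType) (a b : R) : boolean_ring R ->
  atom a -> atom b -> a != b -> a * b = 0.
Proof.
move=> bR [_ aP] [_ bP] ab; case: (bP a) => // E.
by case: (aP b) => E'; rewrite (boolean_mulC _ _ bR) E' in E *; rewrite // E eqxx in ab.
Qed.

(** Distinct atoms of a Boolean ring are orthogonal, so [uniq s] makes this an orthogonal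
    decomposition. *)
Definition atom_sum (R : nzRingType) (x : R) : Prop :=
  exists s : seq R, [/\ uniq s, forall a, a \in s -> atom a
                     & x = \sum_(a <- s) a].

(** An atom occurring in both summands cancels, as [a + a = 0]; multiplication by [b] keeps exactly
    the atoms that [b] fixes. *)
Lemma atom_sum_left_ideal (R : nzRingType) : boolean_ring R ->
  left_ideal (@atom_sum R).
Proof.
move=> bR; split; first by exists [::]; rewrite big_nil.
  move=> x y [s [us sP ->]] [t [ut tP ->]].
  elim: t s us sP ut tP => [|a t IH] s us sP.
    by move=> _ _; exists s; rewrite big_nil addr0.
  move=> /= /andP [nat ut] tP; rewrite big_cons addrCA addrA.
  have tP' b : b \in t -> atom b by move=> bt; apply: tP; rewrite inE bt orbT.
  have [as_|nas] := boolP (a \in s).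
    have -> : a + \sum_(b <- s) b = \sum_(b <- rem a s) b.
      by rewrite (big_rem a as_) /= addrA boolean_addxx // add0r.
    by apply: IH; rewrite ?rem_uniq // => b /mem_rem; exact: sP.
  have -> : a + \sum_(b <- s) b = \sum_(b <- a :: s) b by rewrite big_cons.
  apply: IH; rewrite //= ?nas // => b; rewrite inE => /orP[/eqP ->|/sP //].
  by apply: tP; rewrite mem_head.
move=> b x [s [us sP ->]]; exists [seq a <- s | b * a == a].
split; first exact: filter_uniq.
  by move=> a; rewrite mem_filter => /andP [_]; apply: sP.
rewrite big_filter [RHS]big_mkcond mulr_sumr /=; apply: eq_big_seq => a /sP [_ aP].
by case: (aP b) => ->; rewrite ?eqxx //; case: eqP.
Qed.

(* Maximal left ideals are generated by the complements of atoms, so a maximal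
   one above the ideal of sums of atoms would contain an atom together with its
   complement. *)
Lemma atom_sum1 (R : nzRingType) : semisimple_ring R -> boolean_ring R ->
  atom_sum (1 : R).
Proof.
move=> ss bR; apply: contrapT => nS1.
have [M Mm SM] := maximal_left_ideal_above (atom_sum_left_ideal bR) nS1.
have [lM MT _] := Mm; have [_ MD MM] := lM.
have [m Mm' gen] := semisimple_left_ideal_generator ss lM.
have nM1 : ~ M 1 by move=> M1; apply: MT; exact: left_ideal1.
suff at1m : atom (1 - m).
  apply: nM1; rewrite -(subrK m 1); apply: MD => //; apply: SM.
  exists [:: 1 - m]; split=> //; last by rewrite big_seq1.
  by move=> a; rewrite inE => /eqP ->.
split=> [/eqP|a]; first by rewrite subr_eq0 => /eqP E; apply: nM1; rewrite E.
have killM x : M x -> x * (1 - m) = 0.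
  by move=> Mx; rewrite mulrBr mulr1 -gen // subrr.
have [Ma|nMa] := pselect (M a); [left; exact: killM | right].
have [b Mb] := maximal_left_idealP Mm nMa.
apply/eqP; rewrite -subr_eq0 -[X in _ - X]mul1r -mulrBl -opprB mulNr oppr_eq0.
apply/eqP; apply: killM.
(* Since [b a] is killed by [1 - a], the element [1 - a] is a left multiple of [1 - b a], which lies
   in [M]. *)
have -> : 1 - a = (1 - a) * (1 - b * a).
  rewrite [RHS]mulrBr mulr1 mulrA [X in _ - X * _](boolean_mulC _ _ bR) -mulrA.
  by rewrite [(1 - a) * a]mulrBl mul1r bR subrr mulr0 subr0.
exact: MM.
Qed.

(** With 1 a sum of orthogonal atoms, [x] is the sum of the [x a_i], each 0 or [a_i]; the inverse
    map adds up the atoms whose coordinate is 1. *)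
Lemma boolean_semisimple_F2_power (R : nzRingType) : semisimple_ring R ->
  boolean_ring R -> iso_F2_power R.
Proof.
move=> ss bR; have [s [us sP s1]] := atom_sum1 ss bR.
(* The list is nonempty because [1 != 0], which matches the index type ['I_n.+1]. *)
have [n sn] : exists n, size s = n.+1.
  case: s s1 {us sP} => [|b s] s1; last by exists (size s).
  by have := oner_neq0 R; rewrite s1 big_nil eqxx.
exists n; pose a (i : 'I_n.+1) := s`_i.
have ltis (i : 'I_n.+1) : (i < size s)%N by rewrite sn.
have aP i : atom (a i) by apply: sP; exact: mem_nth.
have a1 : \sum_i a i = 1.
  by rewrite s1 [RHS](big_nth 0) sn big_mkord.
have ainj i j : i != j -> a i * a j = 0.
  move=> ij; apply: boolean_mul_atom => //.
  by apply: contra ij; rewrite nth_uniq.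
have coordE i x : x * a i = if atom_coord (a i) x == 1 then a i else 0.
  case: (aP i) => /eqP ai0 /(_ x); rewrite /atom_coord => -[] ->.
    by rewrite [0 == _]eq_sym (negbTE ai0).
  by rewrite eqxx.
apply: (ring_isoI (f := fun x => [ffun i => atom_coord (a i) x])).
- by move=> x y; apply/ffunP => i; rewrite !ffunE atom_coordD.
- by apply/ffunP => i; rewrite !ffunE atom_coord1.
- by move=> x y; apply/ffunP => i; rewrite !ffunE atom_coordM.
exists (fun phi : {ffun 'I_n.+1 -> 'F_2} =>
  \sum_i if phi i == 1 then a i else 0) => [x|phi].
  rewrite -[RHS]mulr1 -a1 mulr_sumr; apply: eq_bigr => i _.
  by rewrite ffunE coordE.
apply/ffunP => i; rewrite ffunE [RHS]F2E /atom_coord mulr_suml (bigD1 i) //=.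
rewrite big1 => [|j ji]; last first.
  by case: ifP => _; rewrite ?mul0r // ainj.
have /eqP ai0 := (aP i).1; rewrite addr0.
by case: (_ == 1); rewrite ?bR ?eqxx // mul0r [0 == _]eq_sym (negbTE ai0).
Qed.

Theorem theorem2p18 :
  [/\ forall R : nzRingType, division_ring R ->
        (UnitUC R <-> ring_iso R 'F_2),
      forall R : nzRingType, semisimple_ring R ->
        (UnitUC R <-> iso_F2_power R),
      forall R : nzRingType, local_ring R ->
        (UnitUC R <-> ring_iso (Jquot R) 'F_2)
    & forall R : nzRingType, semilocal_ring R ->
        UnitUC R -> iso_F2_power (Jquot R)].
Proof.
have division_F2 (R : nzRingType) : division_ring R -> UnitUC R -> ring_iso R 'F_2.
  move=> dR uc; have reg : regular_ring R.
    move=> x; have [->|/dR [y [xy _]]] := pselect (x = 0).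
      by exists 0; rewrite !mulr0.
    by exists y; rewrite xy mul1r.
  (* A unit satisfying [x x = x] is 1. *)
  apply: F2_iso => x; have [->|/dR [y [xy _]]] := pselect (x = 0); first by left.
  by right; rewrite -[x]mulr1 -xy mulrA (UnitUC_regular_boolean uc reg).
have semisimple_F2 (R : nzRingType) : semisimple_ring R -> UnitUC R -> iso_F2_power R.
  move=> ss uc; apply: boolean_semisimple_F2_power => //.
  exact: semisimple_UnitUC_boolean.
split=> R HR.
- split=> [|iso]; first exact: division_F2.
  by apply: boolean_UnitUC; exact: ring_iso_boolean iso boolean_F2.
- split=> [|[n iso]]; first exact: semisimple_F2.
  by apply: boolean_UnitUC; exact: ring_iso_boolean iso (@boolean_F2_power n).
- split=> [/UnitUC_Jquot|]; [exact: division_F2 | exact: Jquot_F2_UnitUC].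
- by move=> /UnitUC_Jquot; exact: semisimple_F2.
Qed.
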